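(* For every integer $n\geq 4$ there exists a non-trivial element of $\mathcal{K}_n^{\mathrm{ab}}$ whose image under the homomorphism $\mathcal{K}_n^{\mathrm{ab}}\to\mathrm{IA}(W_{n,d})^{\mathrm{ab}}$ induced by the embedding $\mathcal{K}_n\hookrightarrow\mathrm{IA}(W_{n,d})$ is trivial for all $d\geq 3$.
   Context: $F_n$ is the free group of rank $n$ with fixed basis $x_1,\dots,x_n$, and $H:=F_n^{\mathrm{ab}}$. For a group $G$, $G^{\mathrm{ab}}$ is its abelianization. Automorphisms act from the right: $x^\sigma$ is the image of $x$ under $\sigma$, and $x^{\sigma\tau}=(x^\sigma)^\tau$. $\mathrm{IA}_n$ is the kernel of $\mathrm{Aut}\,F_n\to\mathrm{Aut}\,H$. $\mathcal{K}_n$ is the kernel of the Magnus representation $r_M:\mathrm{IA}_n\to\mathrm{GL}(n,\mathbf{Z}[H])$, $\sigma\mapsto\left(\mathfrak{a}\left(\frac{\partial(x_i^\sigma)}{\partial x_j}\right)\right)_{i,j}$, where $\frac{\partial}{\partial x_j}:\mathbf{Z}[F_n]\to\mathbf{Z}[F_n]$ are the Fox derivations (additive maps with $\frac{\partial x_i}{\partial x_j}=\delta_{ij}$ and $\frac{\partial (uv)}{\partial x_j}=\frac{\partial u}{\partial x_j}+u\frac{\partial v}{\partial x_j}$ for $u,v\in F_n$) and $\mathfrak{a}:\mathbf{Z}[F_n]\to\mathbf{Z}[H]$ is induced by abelianization. By a theorem of Bachmuth, $\mathcal{K}_n=\{\sigma\in\mathrm{Aut}\,F_n\mid x^{-1}x^\sigma\in[[F_n,F_n],[F_n,F_n]]\text{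 for all }x\in F_n\}$. For $d\ge2$, let $C_d$ be the cyclic group of order $d$ generated by $s$, and let $W_{n,d}$ be the kernel of the homomorphism $F_n\to C_d$ with $x_1\mapsto s$ and $x_i\mapsto1$ for $i\ne1$. It is a free group of rank $d(n-1)+1$ containing $[F_n,F_n]$. $\mathrm{IA}(W_{n,d})$ is the group of automorphisms of $W_{n,d}$ acting trivially on $W_{n,d}^{\mathrm{ab}}$. Restriction to $W_{n,d}$ gives an injective homomorphism $\mathrm{IA}_n\to\mathrm{Aut}\,W_{n,d}$, which maps $\mathcal{K}_n$ into $\mathrm{IA}(W_{n,d})$; this is the embedding $\mathcal{K}_n\hookrightarrow\mathrm{IA}(W_{n,d})$. *)

(* Defs.v *)
From HB Require Import structures.
From mathcomp.multinomials Require Import monalg.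
From mathcomp Require Import all_boot all_order all_fingroup all_algebra.
From mathcomp Require Import finmap boolp.

Set Implicit Arguments.
Unset Strict Implicit.
Unset Printing Implicit Defensive.

Import GRing.Theory.
Local Open Scope group_scope.
Local Open Scope quotient_scope.

(* The letter (i, b) stands for x_i if b = false, and for x_i^-1 if b = true. *)
Notation letter n := ('I_n * bool)%type.

Section Words.
Variable n : nat.
Implicit Types (a b : letter n) (s u v w : seq (letter n)).

Definition linv a : letter n := (a.1, ~~ a.2).

Definition reduced s := sorted (fun a b => b != linv a) s.

Definition push a s :=
  if s is b :: s' then if b == linv a then s' else a :: s else [:: a].

Definition reduce s := foldr push [::] s.

Lemma linvK : involutive linv.
Proof. by case=> i b; rewrite /linv /= negbK. Qed.

Lemma push_reduced a s : reduced s -> reduced (push a s).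
Proof.
rewrite /reduced; case: s => [//|b s] /= hs; case: eqP => [_|/eqP hb] /=.
  exact: path_sorted hs.
by rewrite hb.
Qed.

Lemma foldr_reduced s u : reduced s -> reduced (foldr push s u).
Proof. by move=> hs; elim: u => //= a u IH; apply: push_reduced. Qed.

Lemma reduce_reduced s : reduced (reduce s).
Proof. exact: foldr_reduced. Qed.

Lemma reduce_id s : reduced s -> reduce s = s.
Proof.
elim: s => //= a s IH hs; rewrite IH; last exact: path_sorted hs.
by case: s hs {IH} => //= b s /andP[/negbTE ->].
Qed.

Lemma pushK a s : reduced s -> push a (push (linv a) s) = s.
Proof.
case: s => [|b s] /=; first by rewrite eqxx.
rewrite linvK; case: eqP => [->|_ _] /=; last by rewrite eqxx.
by case: s => //= c s /andP[/negbTE ->].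
Qed.

Lemma foldr_reduce w s :
  reduced w -> foldr push w (reduce s) = foldr push w s.
Proof.
move=> hw; elim: s => //= a s <-.
case: (reduce s) => //= b r; case: eqP => //= ->.
by rewrite pushK //; apply: foldr_reduced.
Qed.

Lemma reduce_catl u v : reduce (reduce u ++ v) = reduce (u ++ v).
Proof.
by rewrite /reduce !foldr_cat; apply: foldr_reduce; apply: reduce_reduced.
Qed.

Lemma reduce_catr u v : reduce (u ++ reduce v) = reduce (u ++ v).
Proof.
by rewrite /reduce !foldr_cat; congr foldr; apply/reduce_id/reduce_reduced.
Qed.

Definition winv s := rev (map linv s).

Lemma reduce_winvl s : reduce (winv s ++ s) = [::].
Proof.
elim: s => // a s IH; rewrite /winv /= rev_cons cat_rcons -reduce_catr.
have -> : reduce [:: linv a, a & s] = reduce s.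
  by rewrite -[in RHS](pushK (linv a) (reduce_reduced s)) linvK.
by rewrite reduce_catr.
Qed.

Lemma winvK : involutive winv.
Proof. by move=> s; rewrite /winv map_rev revK mapK //; apply: linvK. Qed.

Lemma reduce_winvr s : reduce (s ++ winv s) = [::].
Proof. by rewrite -{1}[s]winvK reduce_winvl. Qed.

Definition free_group : Type := {s : seq (letter n) | reduced s}.
HB.instance Definition _ := SubCountable.on free_group.

Definition fg_of (s : seq (letter n)) : free_group :=
  exist _ (reduce s) (reduce_reduced s).
Definition fg_mul (u v : free_group) : free_group := fg_of (val u ++ val v).
Definition fg_inv (u : free_group) : free_group := fg_of (winv (val u)).

Lemma fg_mulA : associative fg_mul.
Proof.
by move=> u v w; apply: val_inj; rewrite /= reduce_catl reduce_catr catA.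
Qed.
Lemma fg_mul1 : left_id (fg_of [::]) fg_mul.
Proof. by move=> u; apply: val_inj; apply/reduce_id/(valP u). Qed.
Lemma fg_mulr1 : right_id (fg_of [::]) fg_mul.
Proof.
by move=> u; apply: val_inj; rewrite /= cats0; apply/reduce_id/(valP u).
Qed.
Lemma fg_mulV : left_inverse (fg_of [::]) fg_inv fg_mul.
Proof. by move=> u; apply: val_inj; rewrite /= reduce_catl reduce_winvl. Qed.
Lemma fg_mulrV : right_inverse (fg_of [::]) fg_inv fg_mul.
Proof. by move=> u; apply: val_inj; rewrite /= reduce_catr reduce_winvr. Qed.

HB.instance Definition _ :=
  isGroup.Build free_group fg_mulA fg_mul1 fg_mulr1 fg_mulV fg_mulrV.

Definition fg_gen (i : 'I_n) : free_group := fg_of [:: (i, false)].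

Definition letter_val (G : groupType) (f : 'I_n -> G) (a : letter n) : G :=
  if a.2 then (f a.1)^-1 else f a.1.

Definition free_lift (G : groupType) (f : 'I_n -> G) (w : free_group) : G :=
  foldr (fun a g => letter_val f a * g) 1 (val w).

Lemma fg_ofM s t : fg_of (s ++ t) = fg_of s * fg_of t.
Proof. by apply: val_inj; rewrite /= reduce_catl reduce_catr. Qed.

Lemma fg_of_letter (a : letter n) : fg_of [:: a] = letter_val fg_gen a.
Proof. by case: a => i []; apply: val_inj. Qed.

Lemma fg_of_val (w : free_group) : fg_of (val w) = w.
Proof. by apply: val_inj; apply/reduce_id/(valP w). Qed.

Lemma free_group_ind (P : free_group -> Prop) :
  P 1 -> (forall i, P (fg_gen i)) ->
  (forall u v : free_group, P u -> P v -> P (u * v)) ->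
  (forall u : free_group, P u -> P u^-1) -> forall w : free_group, P w.
Proof.
move=> P1 Px PM PV w; rewrite -(fg_of_val w).
elim: (val w) => //= a s IH; rewrite -cat1s fg_ofM; apply: PM => //.
by rewrite fg_of_letter /letter_val; case: a.2 => //; apply: PV.
Qed.

Section Lift.
Variables (G : groupType) (f : 'I_n -> G).

Lemma letter_val_linv a : letter_val f (linv a) = (letter_val f a)^-1.
Proof. by case: a => i []; rewrite /letter_val /= ?invgK. Qed.

Let ev s := foldr (fun a g => letter_val f a * g) 1 s.

Lemma ev_reduce s : ev (reduce s) = ev s.
Proof.
elim: s => //= a s <-; case: (reduce s) => //= b r.
by case: eqP => //= ->; rewrite letter_val_linv mulVKg.
Qed.

Lemma ev_cat s t : ev (s ++ t) = ev s * ev t.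
Proof. by elim: s => [|a s IH] /=; rewrite ?mul1g // IH mulgA. Qed.

Lemma free_liftM : {morph free_lift f : u v / u * v}.
Proof. by move=> u v; rewrite /free_lift -/(ev _) ev_reduce ev_cat. Qed.
Lemma free_lift1 : free_lift f 1 = 1.
Proof. by []. Qed.
Lemma free_lift_gen i : free_lift f (fg_gen i) = f i.
Proof. by rewrite /free_lift /= mulg1. Qed.

HB.instance Definition _ :=
  isUMagmaMorphism.Build free_group G (free_lift f) (free_lift1, free_liftM).
End Lift.
End Words.

Section Abelianization.
Variable G : groupType.

(* The commutator subgroup [G, G].                                           *)
Inductive derived : G -> Prop :=
| Derived1 : derived 1
| DerivedR x y : derived [~ x, y]
| DerivedM x y : derived x -> derived y -> derived (x * y)
| DerivedV x : derived x -> derived x^-1.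

Lemma derivedJ x y : derived x -> derived (x ^ y).
Proof.
move=> dx; rewrite -[x ^ y](mulVKg x) -commgEl.
by apply: DerivedM => //; apply: DerivedR.
Qed.

Definition ab_rel (x y : G) := `[< derived (x^-1 * y) >].

Lemma ab_rel_refl : reflexive ab_rel.
Proof. by move=> x; apply/asboolP; rewrite mulVg; apply: Derived1. Qed.
Lemma ab_rel_sym : symmetric ab_rel.
Proof.
move=> x y; apply/asboolP/asboolP => /DerivedV; by rewrite invgM invgK.
Qed.
Lemma ab_rel_trans : transitive ab_rel.
Proof.
move=> y x z /asboolP h1 /asboolP h2; apply/asboolP.
by have := DerivedM h1 h2; rewrite -mulgA mulVKg.
Qed.

Canonical ab_equiv := EquivRel ab_rel ab_rel_refl ab_rel_sym ab_rel_trans.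

Definition abelianization : Type := {eq_quot ab_equiv}%qT.
HB.instance Definition _ := Choice.on abelianization.

Definition ab (x : G) : abelianization := (\pi_({eq_quot ab_equiv}) x)%qT.
Definition ab_repr (a : abelianization) : G :=
  generic_quotient.repr (a : {eq_quot ab_equiv}%qT).

Lemma ab_reprK : cancel ab_repr ab.
Proof. by move=> a; apply: reprK. Qed.

Lemma abP x y : ab x = ab y <-> derived (x^-1 * y).
Proof.
rewrite /ab; split=> [/eqmodP/asboolP //|h].
by apply/eqmodP/asboolP.
Qed.

Lemma ab_elim (P : abelianization -> Prop) :
  (forall x, P (ab x)) -> forall a, P a.
Proof. by move=> h a; rewrite -(ab_reprK a). Qed.

Definition ab_mul (a b : abelianization) := ab (ab_repr a * ab_repr b).
Definition ab_inv (a : abelianization) := ab (ab_repr a)^-1.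

Lemma ab_mulE x y : ab_mul (ab x) (ab y) = ab (x * y).
Proof.
have hx : derived (x^-1 * ab_repr (ab x)) by apply/abP; rewrite ab_reprK.
have hy : derived (y^-1 * ab_repr (ab y)) by apply/abP; rewrite ab_reprK.
apply/esym/abP.
have := DerivedM (derivedJ y hx) hy.
by rewrite /conjg invgM !mulgA !mulgK.
Qed.

Lemma ab_invE x : ab_inv (ab x) = ab x^-1.
Proof.
have hx : derived (x^-1 * ab_repr (ab x)) by apply/abP; rewrite ab_reprK.
apply/abP; rewrite invgK.
have := derivedJ x^-1 hx.
by rewrite /conjg invgK !mulgA mulgV mul1g.
Qed.

Lemma ab_mulA : associative ab_mul.
Proof.
elim/ab_elim=> x; elim/ab_elim=> y; elim/ab_elim=> z.
by rewrite !ab_mulE mulgA.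
Qed.
Lemma ab_mul1 : left_id (ab 1) ab_mul.
Proof. by elim/ab_elim=> x; rewrite ab_mulE mul1g. Qed.
Lemma ab_mulr1 : right_id (ab 1) ab_mul.
Proof. by elim/ab_elim=> x; rewrite ab_mulE mulg1. Qed.
Lemma ab_mulV : left_inverse (ab 1) ab_inv ab_mul.
Proof. by elim/ab_elim=> x; rewrite ab_invE ab_mulE mulVg. Qed.
Lemma ab_mulrV : right_inverse (ab 1) ab_inv ab_mul.
Proof. by elim/ab_elim=> x; rewrite ab_invE ab_mulE mulgV. Qed.

HB.instance Definition _ :=
  isGroup.Build abelianization ab_mulA ab_mul1 ab_mulr1 ab_mulV ab_mulrV.

Lemma ab1 : ab 1 = 1. Proof. by []. Qed.
Lemma abM : {morph ab : x y / x * y}.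
Proof. by move=> x y; rewrite -ab_mulE. Qed.

HB.instance Definition _ :=
  isUMagmaMorphism.Build G abelianization ab (ab1, abM).

Lemma ab_eq1 x : ab x = 1 <-> derived x.
Proof.
split=> [/esym|h]; first by move/abP; rewrite invg1 mul1g.
by apply/esym/abP; rewrite invg1 mul1g.
Qed.

Lemma abelianizationC : @commutative abelianization _ *%g.
Proof.
elim/ab_elim=> x; elim/ab_elim=> y; rewrite -!abM; apply/abP.
have -> : (x * y)^-1 * (y * x) = [~ y, x] by rewrite /commg /conjg invgM !mulgA.
exact: DerivedR.
Qed.

End Abelianization.

Lemma hom1 (G H : groupType) (f : {multiplicative G -> H}) : f 1 = 1.
Proof. by apply: (mulgI (f 1)); rewrite -gmulfM !mulg1. Qed.

Lemma homV (G H : groupType) (f : {multiplicative G -> H}) x :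
  f x^-1 = (f x)^-1.
Proof. by apply: (mulgI (f x)); rewrite -gmulfM !mulgV hom1. Qed.

Lemma derived_hom (G H : groupType) (f : {multiplicative G -> H}) x :
  derived x -> derived (f x).
Proof.
elim=> [|a b|a b _ da _ db|a _ da]; rewrite ?hom1.
- exact: Derived1.
- by rewrite /commg /conjg !gmulfM !homV; apply: DerivedR.
- by rewrite gmulfM; apply: DerivedM.
- by rewrite homV; apply: DerivedV.
Qed.

Section AbMap.
Variables (G H : groupType) (f : {multiplicative G -> H}).

Definition ab_map (a : abelianization G) : abelianization H :=
  ab (f (ab_repr a)).

Lemma ab_mapE x : ab_map (ab x) = ab (f x).
Proof.
apply/abP; rewrite -homV -gmulfM; apply: derived_hom.
by apply/abP; rewrite ab_reprK.
Qed.

Lemma ab_map1 : ab_map 1 = 1.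
Proof. by rewrite -ab1 ab_mapE hom1. Qed.
Lemma ab_mapM : {morph ab_map : a b / a * b}.
Proof.
elim/ab_elim=> x; elim/ab_elim=> y.
by rewrite -abM !ab_mapE gmulfM abM.
Qed.
HB.instance Definition _ :=
  isUMagmaMorphism.Build (abelianization G) (abelianization H) ab_map
    (ab_map1, ab_mapM).
End AbMap.

Lemma derived_comm (G H : groupType) (f : {multiplicative G -> H}) x :
  @commutative H _ *%g -> derived x -> f x = 1.
Proof.
move=> Hc; elim=> [|a b|a b _ da _ db|a _ da].
- exact: hom1.
- by rewrite /commg /conjg !gmulfM !homV [f a * _]Hc mulKg mulVg.
- by rewrite gmulfM da db mulg1.
- by rewrite homV da invg1.
Qed.

Section Aut.
Variable G : groupType.

Record aut := Aut {
  aut_fun :> G -> G;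
  aut_funM : {morph aut_fun : x y / x * y};
  aut_bij : bijective aut_fun }.

HB.instance Definition _ := gen_eqMixin aut.
HB.instance Definition _ := gen_choiceMixin aut.

Lemma autP (s t : aut) : s =1 t -> s = t.
Proof.
case: s t => f fM fB [g gM gB] /= /funext e; subst g.
by congr Aut; apply: Prop_irrelevance.
Qed.

HB.instance Definition _ (s : aut) :=
  isMultiplicative.Build G G (aut_fun s) (@aut_funM s).

Lemma aut_inv_ex (s : aut) : exists g : G -> G, cancel s g /\ cancel g s.
Proof. by have [g h1 h2] := aut_bij s; exists g. Qed.

Definition aut_ifun (s : aut) : G -> G := projT1 (cid (aut_inv_ex s)).
Lemma aut_ifunK (s : aut) : cancel s (aut_ifun s).
Proof. by rewrite /aut_ifun; case: cid => g []. Qed.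
Lemma aut_ifunVK (s : aut) : cancel (aut_ifun s) s.
Proof. by rewrite /aut_ifun; case: cid => g []. Qed.

Lemma aut_ifunM (s : aut) : {morph aut_ifun s : x y / x * y}.
Proof. exact: can2_gmulfM (@aut_ifunK s) (@aut_ifunVK s). Qed.
Lemma aut_ifun_bij (s : aut) : bijective (aut_ifun s).
Proof. by exists s; [apply: aut_ifunVK | apply: aut_ifunK]. Qed.

Lemma aut_comp_morph (s t : aut) : {morph t \o s : x y / x * y}.
Proof. by move=> x y /=; rewrite !gmulfM. Qed.
Lemma aut_id_morph : {morph (@id G) : x y / x * y}.
Proof. by []. Qed.
Lemma aut_id_bij : bijective (@id G).
Proof. by exists id. Qed.

(* Right action: x^(st) = (x^s)^t. *)
Definition aut_mul (s t : aut) : aut :=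
  Aut (aut_comp_morph s t) (bij_comp (aut_bij t) (aut_bij s)).
Definition aut_one : aut := Aut aut_id_morph aut_id_bij.
Definition aut_inv (s : aut) : aut := Aut (@aut_ifunM s) (aut_ifun_bij s).

Lemma aut_mulA : associative aut_mul.
Proof. by move=> s t u; apply: autP. Qed.
Lemma aut_mul1 : left_id aut_one aut_mul.
Proof. by move=> s; apply: autP. Qed.
Lemma aut_mulr1 : right_id aut_one aut_mul.
Proof. by move=> s; apply: autP. Qed.
Lemma aut_mulV : left_inverse aut_one aut_inv aut_mul.
Proof. by move=> s; apply: autP => x /=; rewrite aut_ifunVK. Qed.
Lemma aut_mulrV : right_inverse aut_one aut_inv aut_mul.
Proof. by move=> s; apply: autP => x /=; rewrite aut_ifunK. Qed.

HB.instance Definition _ :=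
  isGroup.Build aut aut_mulA aut_mul1 aut_mulr1 aut_mulV aut_mulrV.

Lemma aut_mulE (s t : aut) x : (s * t) x = t (s x). Proof. by []. Qed.
Lemma aut_1E x : (1 : aut) x = x. Proof. by []. Qed.
Lemma aut_VK (s : aut) x : s (s^-1 x) = x.
Proof. exact: aut_ifunVK. Qed.
Lemma aut_KV (s : aut) x : s^-1 (s x) = x.
Proof. exact: aut_ifunK. Qed.

(* s lies in the kernel of Aut G -> Aut G^ab.                                *)
Definition is_IA (s : aut) : bool :=
  `[< forall a : abelianization G, ab_map s a = a >].

Lemma is_IAP (s : aut) : reflect (forall x, ab (s x) = ab x) (is_IA s).
Proof.
apply: (iffP (asboolP _)) => [h x|h]; first by rewrite -ab_mapE h.
by elim/ab_elim=> x; rewrite ab_mapE h.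
Qed.

Lemma IA_closed : group_closed is_IA.
Proof.
split=> [|s t /is_IAP hs /is_IAP ht]; apply/is_IAP => x //.
by rewrite aut_mulE -[RHS]hs -[in RHS](aut_VK t (s x)) ht.
Qed.

Definition IA : Type := {s : aut | is_IA s}.
HB.instance Definition _ := SubChoice.on IA.
HB.instance Definition _ :=
  SubChoice_isSubGroup.Build aut is_IA IA IA_closed.

End Aut.

Local Open Scope ring_scope.

Section LinearExtension.
Variables (K : choiceType) (V : zmodType).
Implicit Types (f : K -> V) (y z : {malg int[K]}).

Definition zext f y : V := \sum_(k <- msupp y) f k *~ mcoeff k y.

Lemma zextw f (d : {fset K}) y :
  (msupp y `<=` d)%fset -> zext f y = \sum_(k <- d) f k *~ mcoeff k y.
Proof.
move=> le; rewrite /zext (big_fset_incl _ le) //= => k _ /mcoeff_outdom ->.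
by rewrite mulr0z.
Qed.

Lemma zext_is_zmod_morphism f : zmod_morphism (zext f).
Proof.
move=> y z; pose d := (msupp y `|` msupp z)%fset.
rewrite (@zextw f d (y - z)) ?msuppB_le // (@zextw f d y) ?fsubsetUl //.
rewrite (@zextw f d z) ?fsubsetUr // -sumrB; apply: eq_bigr => k _.
by rewrite mcoeffB mulrzBr.
Qed.
HB.instance Definition _ f :=
  GRing.isZmodMorphism.Build {malg int[K]} V (zext f)
    (zext_is_zmod_morphism f).

Lemma zextU f k : zext f (mkmalgU k 1) = f k.
Proof. by rewrite /zext msuppU big_seq_fset1 mcoeffUU. Qed.

Lemma eq_zext f g : f =1 g -> zext f =1 zext g.
Proof. by move=> e y; apply: eq_bigr => k _; rewrite e. Qed.

Lemma zextB f g y : zext (fun k => f k - g k) y = zext f y - zext g y.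
Proof. by rewrite /zext -sumrB; apply: eq_bigr => k _; rewrite mulrzBl. Qed.
End LinearExtension.

Lemma malg_ind (K : choiceType) (P : {malg int[K]} -> Prop) :
  P 0 -> (forall k, P (mkmalgU k 1)) ->
  (forall y z, P y -> P z -> P (y - z)) -> forall y, P y.
Proof.
move=> P0 P1 PB y.
have PN z : P z -> P (- z) by move=> h; rewrite -sub0r; apply: PB.
have PD z t : P z -> P t -> P (z + t).
  by move=> hz ht; rewrite -[t]opprK; apply: PB => //; apply: PN.
rewrite [y]monalgE; apply: (big_ind P) => // k _.
have Pn m : P (mkmalgU k m%:Z).
  elim: m => [|m IH]; first by rewrite monalgU0.
  by rewrite -addn1 PoszD monalgUD; apply: PD.
by case: (mcoeff k y) => m //; rewrite NegzE monalgUN; apply: PN.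
Qed.

Section GroupRing.
Variable G : groupType.

(* The library makes {malg int[M]} a ring only for monoids M in which 1 is   *)
(* the only unit, so the convolution product is set up here.                *)
Definition group_ring : Type := {malg int[G]}.
HB.instance Definition _ := GRing.Zmodule.on group_ring.
End GroupRing.

(* The basis element g of Z[G]. It and the product are locked, because failed *)
(* unifications would otherwise unfold them to finitely supported functions. *)
HB.lock Definition gr (G : groupType) (g : G) : group_ring G := mkmalgU g 1.

HB.lock Definition gr_mul (G : groupType) (y z : group_ring G) : group_ring G :=
  zext (fun g => zext (fun h => gr (g * h)%g) z) y.

Lemma zext_gr (G : groupType) (V : zmodType) (f : G -> V) g :
  zext f (gr g) = f g.
Proof. by rewrite gr.unlock zextU. Qed.

Section GroupRingTheory.
Variable G : groupType.
Local Notation group_ring := (group_ring G).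
Local Notation gr := (@gr G).
Local Notation gr_mul := (@gr_mul G).

Lemma gr_ind (P : group_ring -> Prop) :
  P 0 -> (forall g, P (gr g)) ->
  (forall y z, P y -> P z -> P (y - z)) -> forall y, P y.
Proof. by rewrite gr.unlock => P0 P1 PB; apply: malg_ind. Qed.

Lemma gr_mulUU g h : gr_mul (gr g) (gr h) = gr (g * h)%g.
Proof. by rewrite gr_mul.unlock !zext_gr. Qed.
Lemma gr_mulBl y z t : gr_mul (y - z) t = gr_mul y t - gr_mul z t.
Proof. by rewrite gr_mul.unlock raddfB. Qed.
Lemma gr_mulBr t y z : gr_mul t (y - z) = gr_mul t y - gr_mul t z.
Proof.
by rewrite gr_mul.unlock -zextB; apply: eq_zext => g; rewrite raddfB.
Qed.
Lemma gr_mul0l y : gr_mul 0 y = 0.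
Proof. by rewrite gr_mul.unlock raddf0. Qed.
Lemma gr_mul0r y : gr_mul y 0 = 0.
Proof. by have := gr_mulBr y y y; rewrite !subrr. Qed.
Lemma gr_mulDl : left_distributive gr_mul +%R.
Proof.
move=> y z t; have := gr_mulBl (y + z) z t.
by rewrite addrK => ->; rewrite subrK.
Qed.
Lemma gr_mulDr : right_distributive gr_mul +%R.
Proof.
move=> t y z; have := gr_mulBr t (y + z) z.
by rewrite addrK => ->; rewrite subrK.
Qed.
Lemma gr_mul1l : left_id (gr 1%g) gr_mul.
Proof.
elim/gr_ind=> [|g|y z hy hz]; first by rewrite gr_mul0r.
  by rewrite gr_mulUU mul1g.
by rewrite gr_mulBr hy hz.
Qed.
Lemma gr_mul1r : right_id (gr 1%g) gr_mul.
Proof.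
elim/gr_ind=> [|g|y z hy hz]; first by rewrite gr_mul0l.
  by rewrite gr_mulUU mulg1.
by rewrite gr_mulBl hy hz.
Qed.
Lemma gr_mulA : associative gr_mul.
Proof.
elim/gr_ind=> [|g|y y' hy hy'] z t; first by rewrite !gr_mul0l.
  elim/gr_ind: z => [|h|z z' hz hz']; first by rewrite !(gr_mul0l, gr_mul0r).
    elim/gr_ind: t => [|k|t t' ht ht']; first by rewrite !gr_mul0r.
      by rewrite !gr_mulUU mulgA.
    by rewrite !gr_mulBr ht ht'.
  by rewrite !(gr_mulBl, gr_mulBr) hz hz'.
by rewrite !gr_mulBl hy hy'.
Qed.
Lemma gr_neq0 : gr 1%g != 0.
Proof. by rewrite gr.unlock monalgU_eq0 oner_eq0. Qed.

HB.instance Definition _ := GRing.Zmodule_isNzRing.Build group_ring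
  gr_mulA gr_mul1l gr_mul1r gr_mulDl gr_mulDr gr_neq0.

Lemma grM g h : gr (g * h)%g = gr g * gr h.
Proof. by rewrite -gr_mulUU. Qed.
Lemma gr1 : gr 1%g = 1.
Proof. by []. Qed.
Lemma gr_inj : injective gr.
Proof.
move=> g h /(congr1 (mcoeff h)); rewrite gr.unlock mcoeffUU mcoeffU.
by case: eqP.
Qed.
End GroupRingTheory.

Definition gr_map (G H : groupType) (f : G -> H) :
  group_ring G -> group_ring H := zext (fun g => gr (f g)).
HB.instance Definition _ G H f :=
  GRing.isZmodMorphism.Build (group_ring G) (group_ring H) (@gr_map G H f)
    (zext_is_zmod_morphism _).

Lemma gr_mapU (G H : groupType) (f : G -> H) g : gr_map f (gr g) = gr (f g).
Proof. exact: zext_gr. Qed.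

Lemma gr_mapD (G H : groupType) (f : G -> H) : {morph gr_map f : y z / y + z}.
Proof. exact: raddfD. Qed.

Lemma gr_mapN (G H : groupType) (f : G -> H) : {morph gr_map f : y / - y}.
Proof. exact: raddfN. Qed.

Lemma gr_mapM (G H : groupType) (f : G -> H) (fM : {morph f : x y / (x * y)%g})
  y z : gr_map f (y * z) = gr_map f y * gr_map f z.
Proof.
elim/gr_ind: y => [|g|y y' hy hy']; first by rewrite mul0r !raddf0 mul0r.
  elim/gr_ind: z => [|h|z z' hz hz']; first by rewrite mulr0 !raddf0 mulr0.
    by rewrite -grM !gr_mapU fM grM.
  by rewrite mulrBr !raddfB /= mulrBr hz hz'.
by rewrite mulrBl !raddfB /= mulrBl hy hy'.
Qed.

Section Fox.
Variable n : nat.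
Implicit Types (j : 'I_n) (u v w : free_group n).

Definition fox_letter j (a : letter n) : group_ring (free_group n) :=
  if a.1 == j then (if a.2 then - gr (fg_gen j)^-1%g else 1) else 0.

Fixpoint fox_word j (s : seq (letter n)) : group_ring (free_group n) :=
  if s is a :: s' then
    fox_letter j a + gr (letter_val (@fg_gen n) a) * fox_word j s'
  else 0.

Definition fox j :
    group_ring (free_group n) -> group_ring (free_group n) :=
  zext (fun w => fox_word j (val w)).
HB.instance Definition _ j :=
  GRing.isZmodMorphism.Build (group_ring (free_group n))
    (group_ring (free_group n)) (fox j) (zext_is_zmod_morphism _).

Lemma foxU j w : fox j (gr w) = fox_word j (val w).
Proof. exact: zext_gr. Qed.

Lemma fox1 j : fox j (gr 1%g) = 0.
Proof. by rewrite foxU. Qed.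

Lemma fox_gen j i : fox j (gr (fg_gen i)) = (i == j)%:R.
Proof.
by rewrite foxU /= /fox_letter /= mulr0 addr0; case: eqP.
Qed.

Lemma fox_word_push j a s :
  fox_word j (push a s) =
  fox_letter j a + gr (letter_val (@fg_gen n) a) * fox_word j s.
Proof.
case: s => [|b s] //=; case: eqP => //= ->.
rewrite mulrDr addrA mulrA -grM letter_val_linv mulgV gr1 mul1r.
rewrite [X in _ = X + _](_ : _ = 0) ?add0r //.
rewrite /fox_letter /linv /letter_val /=; case: a => i [] /=; case: eqP => [->|_];
  rewrite ?mulr0 ?addr0 // ?mulr1 ?addNr // mulrN -grM mulgV gr1 subrr //.
Qed.

Lemma foxM j u v : fox j (gr (u * v)%g) = fox j (gr u) + gr u * fox j (gr v).
Proof.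
rewrite !foxU -[in gr u](fg_of_val u) /= /reduce foldr_cat.
have -> : foldr (@push n) [::] (val v) = val v by apply/reduce_id/(valP v).
elim: (val u) => [|a s IH] /=; first by rewrite add0r gr1 mul1r.
rewrite fox_word_push IH mulrDr addrA mulrA -grM.
by rewrite -cat1s fg_ofM fg_of_letter.
Qed.

Lemma foxV j u : fox j (gr u^-1%g) = - gr u^-1%g * fox j (gr u).
Proof.
apply/eqP; rewrite mulNr -addr_eq0; apply/eqP.
by rewrite -foxM mulVg fox1.
Qed.

(* fox j is characterized by additivity, fox_gen and foxM; row i of the      *)
(* matrix holds the derivatives of x_i^s, pushed to Z[H].                    *)
Definition magnus (s : IA (free_group n)) :
    'M[group_ring (abelianization (free_group n))]_n :=
  \matrix_(i, j) gr_map (@ab _) (fox j (gr (val s (fg_gen i)))).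

Lemma IA_ab (s : IA (free_group n)) w : ab (val s w) = ab w.
Proof. by move: w; apply/is_IAP/(valP s). Qed.

Lemma magnus_chain (s : IA (free_group n)) j w :
  gr_map (@ab _) (fox j (gr (val s w))) =
  \sum_k gr_map (@ab _) (fox k (gr w)) * magnus s k j.
Proof.
elim/free_group_ind: w => [|i|u v hu hv|u hu].
- rewrite (hom1 (val s)) fox1 raddf0 big1 // => k _.
  by rewrite fox1 raddf0 mul0r.
- rewrite (bigD1 i) //= fox_gen eqxx -gr1 gr_mapU ab1 gr1 mul1r mxE.
  rewrite big1 ?addr0 // => k /negbTE ik.
  by rewrite fox_gen eq_sym ik raddf0 mul0r.
- rewrite aut_funM foxM gr_mapD (gr_mapM (@abM _)) gr_mapU IA_ab hu hv mulr_sumr.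
  rewrite -big_split /=; apply: eq_bigr => k _.
  by rewrite foxM gr_mapD (gr_mapM (@abM _)) gr_mapU mulrDl mulrA.
- rewrite (homV (val s)) foxV mulNr gr_mapN (gr_mapM (@abM _)) gr_mapU -(homV (val s)) IA_ab hu mulr_sumr.
  rewrite -sumrN; apply: eq_bigr => k _.
  by rewrite foxV mulNr gr_mapN (gr_mapM (@abM _)) gr_mapU mulNr mulrA.
Qed.

Lemma magnus1 : magnus 1%g = 1%:M.
Proof.
apply/matrixP=> i j; rewrite !mxE fox_gen.
by case: eqP => _; rewrite ?raddf0 // -gr1 gr_mapU.
Qed.

Lemma magnusM (s t : IA (free_group n)) :
  magnus (s * t)%g = magnus s *m magnus t.
Proof.
apply/matrixP=> i j; rewrite [LHS]mxE [RHS]mxE.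
have -> : val (s * t)%g (fg_gen i) = val t (val s (fg_gen i)) by rewrite valM.
by rewrite magnus_chain; apply: eq_bigr => k _; rewrite [magnus s i k]mxE.
Qed.

Definition in_magnus_kernel (s : IA (free_group n)) : bool :=
  magnus s == 1%:M.

Lemma magnus_kernel_closed : group_closed in_magnus_kernel.
Proof.
split=> [|s t]; first by apply/eqP/magnus1.
move=> /eqP hs /eqP ht; apply/eqP; rewrite magnusM hs mul1mx.
by rewrite -[LHS]mul1mx -ht -magnusM mulgV magnus1.
Qed.

Definition magnus_kernel : Type :=
  {s : IA (free_group n) | in_magnus_kernel s}.
HB.instance Definition _ := SubChoice.on magnus_kernel.
HB.instance Definition _ :=
  SubChoice_isSubGroup.Build (IA (free_group n)) in_magnus_kernel
    magnus_kernel magnus_kernel_closed.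

Lemma magnus_kernel_fox (s : magnus_kernel) j w :
  gr_map (@ab _) (fox j (gr (val (val s) w))) =
  gr_map (@ab _) (fox j (gr w)).
Proof.
have e : magnus (val s) = 1%:M by apply/eqP; apply: (valP s).
rewrite magnus_chain e (bigD1 j) //=.
have -> : (1%:M : 'M[group_ring (abelianization (free_group n))]_n) j j = 1.
  by rewrite mxE eqxx.
rewrite -[RHS]addr0; congr +%R; first exact: mulr1.
apply: big1 => k /negbTE kj; rewrite [X in _ * X]mxE kj.
exact: mulr0.
Qed.

End Fox.

Local Close Scope ring_scope.

(* F_n -> C_d, mapping x_1 to the generator Zp1 and the other x_i to 1; C_d  *)
(* is the additive group 'Z_d, of order d for d > 1, and 'I_n starts at 0.   *)
Definition to_cyclic (n d : nat) : free_group n -> 'Z_d :=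
  free_lift (fun i : 'I_n => if val i == 0%N then (Zp1 : 'Z_d) else 1).
HB.instance Definition _ n d :=
  UMagmaMorphism.on (@to_cyclic n d).

Lemma to_cyclic1 n d : to_cyclic d (1 : free_group n) = 1.
Proof. exact: gmulf1. Qed.
Lemma to_cyclicM n d : {morph @to_cyclic n d : u v / u * v}.
Proof. exact: gmulfM. Qed.
Lemma to_cyclicV n d : {morph @to_cyclic n d : u / u^-1}.
Proof. exact: homV. Qed.

Section W.
Variables n d : nat.
Local Notation F := (free_group n).
Local Notation p := (@to_cyclic n d).

Definition in_W (w : F) : bool := p w == 1.

Lemma W_closed : group_closed in_W.
Proof.
split=> [|u v /eqP hu /eqP hv]; apply/eqP; first exact: to_cyclic1.
by rewrite to_cyclicM to_cyclicV hu hv invg1 mulg1.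
Qed.

Definition W : Type := {w : F | in_W w}.
HB.instance Definition _ := SubChoice.on W.
HB.instance Definition _ := SubChoice_isSubGroup.Build F in_W W W_closed.

Lemma IA_to_cyclic (s : IA F) w : p (val s w) = p w.
Proof.
have /derived_comm h : derived (w^-1 * val s w) by apply/abP; rewrite IA_ab.
have /= := h _ p (@Zp_mulgC _); rewrite to_cyclicM to_cyclicV => e.
by rewrite -[LHS](mulVKg (p w)) e mulg1.
Qed.

Lemma IA_in_W (s : IA F) (w : W) : in_W (val s (val w)).
Proof. by rewrite /in_W IA_to_cyclic; apply: (valP w). Qed.

Definition W_fun (s : IA F) (w : W) : W := exist _ (val s (val w)) (IA_in_W s w).

Lemma W_funM s : {morph W_fun s : u v / u * v}.
Proof. by move=> u v; apply: val_inj; rewrite /= aut_funM. Qed.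

Lemma W_fun_comp s t w : W_fun (s * t) w = W_fun t (W_fun s w).
Proof. exact: val_inj. Qed.
Lemma W_fun1 w : W_fun 1 w = w.
Proof. exact: val_inj. Qed.

Lemma W_fun_bij s : bijective (W_fun s).
Proof.
by exists (W_fun s^-1) => w; rewrite -W_fun_comp ?mulgV ?mulVg W_fun1.
Qed.

Definition restrict_W (s : IA F) : aut W := Aut (@W_funM s) (W_fun_bij s).

Lemma restrict_W1 : restrict_W 1 = 1.
Proof. by apply: autP => w; apply: W_fun1. Qed.
Lemma restrict_WM : {morph restrict_W : s t / s * t}.
Proof. by move=> s t; apply: autP => w; apply: W_fun_comp. Qed.
HB.instance Definition _ :=
  isUMagmaMorphism.Build (IA F) (aut W) restrict_W (restrict_W1, restrict_WM).

End W.

(* G^ab, written additively.                                                 *)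
Definition additive_ab (G : groupType) : Type := abelianization G.
HB.instance Definition _ G := Choice.on (additive_ab G).
HB.instance Definition _ G := GRing.isZmodule.Build (additive_ab G)
  (@mulgA (abelianization G)) (@abelianizationC G) (@mul1g (abelianization G))
  (@mulVg (abelianization G)).

Section Schreier.
Variables n d : nat.
Local Notation F := (free_group n).
Local Notation p := (@to_cyclic n d).
Local Notation W := (W n d).

Local Notation A := (additive_ab W).

Let theta (u : F) : A := ab (insubd (1 : W) u).

Let thetaM u v : in_W d u -> in_W d v -> theta (u * v) = (theta u + theta v)%R.
Proof.
move=> hu hv; have huv : in_W d (u * v) by apply: (group_closedM (@W_closed n d)).
rewrite /theta [RHS](_ : _ = ab (insubd (1 : W) u) * ab (insubd (1 : W) v)) //.
rewrite -abM; congr ab; apply: val_inj.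
by rewrite valM !val_insubd hu hv huv.
Qed.

Let thetaV u : in_W d u -> theta u^-1 = (- theta u)%R.
Proof.
move=> hu; have hv := group_closedV (@W_closed n d) hu.
apply/eqP; rewrite -GRing.addr_eq0 -thetaM // mulVg.
have e1 : insubd (1 : W) (1 : F) = 1.
  by apply: val_inj; rewrite insubdK //; apply: (W_closed n d).1.
by rewrite /theta e1.
Qed.

Let transversal : exists t : 'Z_d -> F, forall w, p (t (p w)) = p w.
Proof.
have h c : exists u : F, forall w, p w = c -> p u = c.
  have [[u hu]|hn] := pselect (exists u, p u = c); first by exists u.
  by exists 1 => w hw; case: hn; exists w.
by have [t ht] := choice h; exists t => w; apply: (ht (p w) w).
Qed.

Let t : 'Z_d -> F := projT1 (cid transversal).
Let tE w : p (t (p w)) = p w.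
Proof. exact: (projT2 (cid transversal)). Qed.

Let edge (g w : F) : F := t (p g) * w * (t (p (g * w)))^-1.

Let edge_in g w : in_W d (edge g w).
Proof. by rewrite /in_W /edge 2!to_cyclicM to_cyclicV !tE to_cyclicM mulgV. Qed.

Let edgeM g u v : edge g (u * v) = edge g u * edge (g * u) v.
Proof. by rewrite /edge !mulgA mulgVK. Qed.

Let edgeV g u : edge g u^-1 = (edge (g * u^-1) u)^-1.
Proof. by rewrite /edge !invgM invgK mulgVK !mulgA. Qed.

(* The left inverse to the Fox Jacobian on W^ab given by the transversal t.  *)
Let phi (y : 'I_n -> group_ring F) : A :=
  (\sum_j zext (fun g => theta (edge g (fg_gen j))) (y j))%R.

Let phi_add y z : phi (fun j => y j + z j)%R = (phi y + phi z)%R.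
Proof. by rewrite /phi -big_split; apply: eq_bigr => j _; rewrite raddfD. Qed.
Let phi_opp y : phi (fun j => - y j)%R = (- phi y)%R.
Proof. by rewrite /phi -sumrN; apply: eq_bigr => j _; rewrite raddfN. Qed.

Let phi_fox w g : phi (fun j => gr g * fox j (gr w))%R = theta (edge g w).
Proof.
elim/free_group_ind: w g => [|i|u v hu hv|u hu] g.
- rewrite /phi big1 => [|j _]; last by rewrite fox1 mulr0 raddf0.
  have h := thetaM (edge_in g 1) (edge_in g 1).
  have e : edge g 1 * edge g 1 = edge g 1.
    by have := edgeM g 1 1; rewrite !mulg1.
  by rewrite e in h; apply/esym/(addrI (theta (edge g 1))); rewrite addr0.
- rewrite /phi (bigD1 i) //= fox_gen eqxx mulr1 zext_gr big1 ?addr0 // => j ji.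
  by rewrite fox_gen eq_sym (negbTE ji) mulr0 raddf0.
- rewrite edgeM thetaM // -hu -hv -phi_add; congr phi; apply: funext => j.
  by rewrite foxM mulrDr mulrA grM.
- rewrite edgeV thetaV // -hu -phi_opp; congr phi; apply: funext => j.
  by rewrite foxV mulNr mulrN mulrA grM.
Qed.

Let phi_ab y z : (forall j, gr_map (@ab F) (y j) = gr_map (@ab F) (z j)) ->
  phi y = phi z.
Proof.
move=> h; apply: eq_bigr => j _.
pose f (a : abelianization F) := theta (edge (ab_repr a) (fg_gen j)).
have pE g : p (ab_repr (ab g)) = p g.
  have /derived_comm e : derived (g^-1 * ab_repr (ab g)).
    by apply/abP; rewrite ab_reprK.
  have /= := e _ p (@Zp_mulgC _); rewrite to_cyclicM to_cyclicV => e'.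
  by rewrite -[LHS](mulVKg (p g)) e' mulg1.
suff H x : zext (fun g => theta (edge g (fg_gen j))) x = zext f (gr_map (@ab F) x).
  by rewrite !H h.
elim/gr_ind: x => [|g|x x' hx hx']; first by rewrite !raddf0.
  by rewrite gr_mapU !zext_gr /f /edge !to_cyclicM pE.
by rewrite !raddfB /= hx hx'.
Qed.

Lemma magnus_kernel_IA (s : magnus_kernel n) : is_IA (restrict_W d (val s)).
Proof.
apply/is_IAP => w.
have e : theta (edge 1 (val (val s) (val w))) = theta (edge 1 (val w)).
  rewrite -!phi_fox; apply: phi_ab => j.
  by rewrite gr1 !mul1r magnus_kernel_fox.
have t1 : in_W d (t (p 1)) by rewrite /in_W tE to_cyclic1.
have t1' := group_closedV (@W_closed n d) t1.
have tw (v : W) : theta (edge 1 (val v)) = ab v.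
  rewrite /edge mul1g (eqP (valP v)) -[in X in _ * X](@to_cyclic1 n d).
  have hv := valP v.
  rewrite thetaM ?thetaM ?thetaV //; last first.
    exact: (group_closedM (@W_closed n d)).
  rewrite addrAC subrr add0r.
  by congr ab; apply: val_inj; rewrite val_insubd hv.
by move: e; rewrite (tw w) (tw (W_fun (val s) w)).
Qed.

End Schreier.

Section Embedding.
Variables n d : nat.

(* Restriction of automorphisms from F_n to W_{n,d}.                        *)
Definition embed_IA_W (s : magnus_kernel n) : IA (W n d) :=
  exist _ (restrict_W d (val s)) (magnus_kernel_IA d s).

Lemma embed_IA_W1 : embed_IA_W 1 = 1.
Proof. by apply: val_inj; apply: restrict_W1. Qed.
Lemma embed_IA_WM : {morph embed_IA_W : s t / s * t}.
Proof. by move=> s t; apply: val_inj; rewrite /= -restrict_WM. Qed.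
HB.instance Definition _ :=
  isUMagmaMorphism.Build (magnus_kernel n) (IA (W n d)) embed_IA_W
    (embed_IA_W1, embed_IA_WM).

End Embedding.

(* Main.v *)
Require Import Defs.
From mathcomp Require Import all_boot.
From HB Require Import structures.
From mathcomp Require Import all_algebra ring.

Set Implicit Arguments.
Unset Strict Implicit.
Unset Printing Implicit Defensive.

Import GRing.Theory.
Local Open Scope group_scope.

(** Write F for F_n, F' = [F, F], and let c = [x_1, x_2], g = [x_2, x_3].
    Consider two elements of IA_n that move only x_4:
      S : x_4 |-> x_4 g   and   T : x_4 |-> c^-1 x_4 c.
    Their commutator is R : x_4 |-> x_4 [c^-1, g^-1].  Since c and g lie in F',
    the correction [c^-1, g^-1] lies in F'', so R is in the Magnus kernel
    ([fox_ab_comm], [in_magnus_kernel_fox]).  Its class is the one wanted.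

    The class dies in IA(W)^ab for every W = W_{n,d}.  Although neither S nor T
    lies in the Magnus kernel, both restrict to elements of IA(W), so the
    restriction of R is a commutator in IA(W).  Indeed x_2, x_3, x_4 and c lie
    in W, so x_4^-1 x_4^S = [x_2, x_3] and x_4^-1 x_4^T = [x_4, c] lie in [W, W];
    as [W, W] is normal in F, the congruence x^s = x mod [W, W] spreads from the
    generators to all of F ([restrict_W_IA]).

    The class is non-trivial in K_n^ab.  Represent F in the group of matrices
      [1 a z; 0 e b; 0 0 1],   e = 1 or -1,   a, b, z integers,
    a semidirect product of the integral Heisenberg group by an element of order
    two acting as -1 on (a, b) and trivially on z.  The image of F' has e = 1,
    and (a, b) is additive there; by the injectivity of the Magnus embedding
    F'/F'' -> Z[H]^n ([fox_vanishing]) every s in K_n satisfies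
    (a, b)(x^-1 x^s) = 0, so rho(x^-1 x^s) is a central matrix
    ([magnus_kernel_central]).  It follows that s |-> rho(x^-1 x^s) is a
    homomorphism from K_n to a commutative group for each x
    ([magnus_kernel_defectM]).  For x = x_4 it maps R to rho([c^-1, g^-1]),
    which is not 1 when x_1 and x_3 go to the two standard Heisenberg
    generators and x_2 goes to diag(1, -1, 1). *)

(** * Homomorphisms with commuting values *)

Lemma abV (G : groupType) : {morph @ab G : x / x^-1}.
Proof. exact: homV. Qed.

(** A variant of [derived_comm] for maps into a non-commutative group of which
    only the values commute. *)
Lemma derived_commuting (G Q : groupType) (f : G -> Q) x :
  {morph f : x y / x * y} -> (forall x y, f x * f y = f y * f x) ->
  derived x -> f x = 1.
Proof.
move=> fM fC; have f1 : f 1 = 1 by apply: (mulgI (f 1)); rewrite -fM !mulg1.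
have fV y : f y^-1 = (f y)^-1 by apply: (mulgI (f y)); rewrite -fM !mulgV.
elim=> [//|y z|y z _ hy _ hz|y _ hy].
- by rewrite /commg /conjg !fM !fV [f y * _]fC mulKg mulVg.
- by rewrite fM hy hz mulg1.
- by rewrite fV hy invg1.
Qed.

(** * Injectivity of the Magnus embedding on F'/F'' *)

Lemma zextN (G : groupType) (V : zmodType) (f : G -> V) (y : group_ring G) :
  zext f (- y)%R = (- zext f y)%R.
Proof.
apply/eqP; rewrite -addr_eq0; apply/eqP.
transitivity (zext f (- y + y)%R); first exact/esym/raddfD.
by rewrite addNr raddf0.
Qed.

Section Vanishing.
Variables (n : nat) (A : zmodType) (theta : free_group n -> A).
Hypothesis thetaM : forall u v, derived u -> derived v ->
  theta (u * v) = (theta u + theta v)%R.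
Local Notation F := (free_group n).
Local Notation H := (abelianization F).

Let theta1 : theta 1 = 0%R.
Proof.
have := thetaM (Derived1 F) (Derived1 F); rewrite mulg1 => h.
by apply/esym/(addrI (theta 1)); rewrite addr0.
Qed.

Let thetaV u : derived u -> theta u^-1 = (- theta u)%R.
Proof.
move=> du; apply/eqP; rewrite -addr_eq0 -(thetaM (DerivedV du) du).
by rewrite mulVg theta1.
Qed.

(* The Schreier generators of F' for the transversal ab_repr : H -> F, extended
   from letters to words: edge a w is the loop that follows w from the coset a. *)
Let edge (a : H) (w : F) : F := ab_repr a * w * (ab_repr (a * ab w))^-1.

Let edge_derived a w : derived (edge a w).
Proof. by apply/ab_eq1; rewrite !abM abV !ab_reprK mulgV. Qed.

Let edgeM a u v : edge a (u * v) = edge a u * edge (a * ab u) v.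
Proof. by rewrite /edge abM !mulgA mulgVK. Qed.

Let edgeV a u : edge a u^-1 = (edge (a * ab u^-1) u)^-1.
Proof. by rewrite /edge abV !invgM invgK mulgVK !mulgA. Qed.

(* The left inverse to the Fox Jacobian, composed with theta; it needs the
   derivatives only modulo F', as edge a w depends on the coset a alone. *)
Let phi (y : 'I_n -> group_ring H) : A :=
  (\sum_j zext (fun a => theta (edge a (fg_gen j))) (y j))%R.

Let phi_fox w a :
  phi (fun j => gr a * gr_map (@ab F) (fox j (gr w)))%R = theta (edge a w).
Proof.
elim/free_group_ind: w a => [|i|u v hu hv|u hu] a.
- rewrite /edge ab1 !mulg1 mulgV theta1 /phi big1 // => j _.
  by rewrite fox1 raddf0 mulr0 raddf0.
- rewrite /phi (bigD1 i) //= fox_gen eqxx -gr1 gr_mapU gr1 mulr1 zext_gr.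
  rewrite big1 ?addr0 // => j /negbTE ji.
  by rewrite fox_gen eq_sym ji raddf0 mulr0 raddf0.
- rewrite edgeM thetaM // -hu -hv /phi -big_split; apply: eq_bigr => j _ /=.
  by rewrite -raddfD foxM gr_mapD (gr_mapM (@abM _)) gr_mapU mulrDr mulrA grM.
- rewrite edgeV thetaV // -hu /phi -sumrN; apply: eq_bigr => j _ /=.
  rewrite foxV mulNr gr_mapN (gr_mapM (@abM _)) gr_mapU.
  by rewrite mulrN zextN mulrA grM.
Qed.

(** Elements of F' whose abelianized Fox derivatives all vanish lie in F'': this
    says so in the dual form, through the additive functions theta on F'.  Such a
    theta factors through the Fox derivatives in Z[H], because it can be computed
    on a word letter by letter along its path in the Cayley graph of H. *)
Lemma fox_vanishing w : derived w ->
  (forall j, gr_map (@ab F) (fox j (gr w)) = 0%R) -> theta w = 0%R.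
Proof.
move=> dw w0; have dt : derived (ab_repr (1 : H)) by apply/ab_eq1/ab_reprK.
have /ab_eq1 w1 := dw.
(* As w ends at the coset where it starts, edge 1 w is the conjugate of w by an
   element of F', to which theta gives the same value as to w. *)
have := phi_fox w 1; rewrite /edge w1 mulg1.
rewrite thetaM ?thetaM ?thetaV //; try exact: DerivedM; try exact: DerivedV.
rewrite addrAC subrr add0r => <-.
by rewrite /phi big1 // => j _; rewrite w0 mulr0 raddf0.
Qed.

End Vanishing.

(** * The Heisenberg group extended by -1 *)

(** The quadruple (e, a, b, z) stands for the matrix [1 a z; 0 (-1)^e b; 0 0 1]. *)
Definition heis : Type := (bool * int * int * int)%type.
HB.instance Definition _ := Choice.on heis.

Definition hsgn (e : bool) : int := if e then (-1)%R else 1%R.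

Definition heis_one : heis := (false, 0, 0, 0)%R.
Definition heis_mul (p q : heis) : heis :=
  let: (e, a, b, z) := p in let: (e', a', b', z') := q in
  (e (+) e', a' + a * hsgn e', hsgn e * b' + b, z' + a * b' + z)%R.
Definition heis_inv (p : heis) : heis :=
  let: (e, a, b, z) := p in
  (e, - hsgn e * a, - hsgn e * b, hsgn e * a * b - z)%R.

Lemma heis_mulA : associative heis_mul.
Proof.
case=> [[[e a] b] z] [[[e' a'] b'] z'] [[[e'' a''] b''] z''] /=.
by rewrite addbA; congr (_, _, _, _); case: e; case: e'; case: e'';
  rewrite /hsgn /=; ring.
Qed.
Lemma heis_mul1 : left_id heis_one heis_mul.
Proof. by case=> [[[e a] b] z] /=; congr (_, _, _, _); rewrite /hsgn; ring. Qed.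
Lemma heis_mulr1 : right_id heis_one heis_mul.
Proof.
by case=> [[[e a] b] z] /=; rewrite addbF; congr (_, _, _, _);
  rewrite /hsgn; ring.
Qed.
Lemma heis_mulV : left_inverse heis_one heis_inv heis_mul.
Proof.
case=> [[[e a] b] z] /=; rewrite addbb; congr (_, _, _, _);
  by case: e; rewrite /hsgn; ring.
Qed.
Lemma heis_mulrV : right_inverse heis_one heis_inv heis_mul.
Proof.
case=> [[[e a] b] z] /=; rewrite addbb; congr (_, _, _, _);
  by case: e; rewrite /hsgn; ring.
Qed.
HB.instance Definition _ :=
  isGroup.Build heis heis_mulA heis_mul1 heis_mulr1 heis_mulV heis_mulrV.

Lemma heisM (p q : heis) : p * q = heis_mul p q. Proof. by []. Qed.

Definition heis_sign (p : heis) : bool := p.1.1.1.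
Definition heis_vec (p : heis) : int * int := (p.1.1.2, p.1.2).

Lemma heis_signM p q : heis_sign (p * q) = heis_sign p (+) heis_sign q.
Proof. by case: p q => [[[? ?] ?] ?] [[[? ?] ?] ?]. Qed.
Lemma heis_signV p : heis_sign p^-1 = heis_sign p.
Proof. by case: p => [[[? ?] ?] ?]. Qed.

Lemma derived_heis_sign p : derived p -> heis_sign p = false.
Proof.
elim=> [//|x y|x y _ hx _ hy|x _ hx]; rewrite ?heis_signM ?heis_signV ?hx ?hy //.
by case: (heis_sign x); case: (heis_sign y).
Qed.

Lemma heis_vecM p q : heis_sign p = false -> heis_sign q = false ->
  heis_vec (p * q) = (heis_vec p + heis_vec q)%R.
Proof.
case: p q => [[[e a] b] z] [[[e' a'] b'] z']; rewrite /heis_sign /= => -> ->.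
by congr (_, _); rewrite /hsgn /=; ring.
Qed.

(** The matrices with e = 0 and (a, b) = 0 are central because the sign acts on
    z trivially. *)
Lemma heis_central p q : heis_sign p = false -> heis_vec p = 0%R -> p * q = q * p.
Proof.
case: p q => [[[e a] b] z] [[[e' a'] b'] z']; rewrite /heis_sign /= => -> [-> ->].
by rewrite !heisM /= addbF; congr (_, _, _, _); rewrite /hsgn /=; ring.
Qed.

(** * Characters of the Magnus kernel *)

Section Detection.
Variables (n : nat) (rho : {multiplicative free_group n -> heis}).
Implicit Types (s t : magnus_kernel n) (x u : free_group n).

Local Notation "x ^@ s" := (val (val s) x) (at level 30).

(** The coordinates (a, b) are additive on the image of F', so they vanish on
    x^-1 x^s by [fox_vanishing]. *)
Lemma magnus_kernel_central s x (q : heis) :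
  rho (x^-1 * x ^@ s) * q = q * rho (x^-1 * x ^@ s).
Proof.
have dx : derived (x^-1 * x ^@ s) by apply/abP; rewrite IA_ab.
apply: heis_central; first exact/derived_heis_sign/derived_hom.
apply: (@fox_vanishing n _ (fun u => heis_vec (rho u))) => // [u v du dv|j].
  by rewrite gmulfM heis_vecM //; apply/derived_heis_sign/derived_hom.
rewrite foxM gr_mapD (gr_mapM (@abM _)) magnus_kernel_fox.
by rewrite -(gr_mapM (@abM _)) -gr_mapD -foxM mulVg fox1 raddf0.
Qed.

(* For fixed s, the map rho o s is a homomorphism that differs from rho by the
   central factor zeta s, which is therefore a homomorphism itself. *)
Let zeta s x := rho (x^-1 * x ^@ s).

Let zetaM s x y : zeta s (x * y) = zeta s x * zeta s y.
Proof.
rewrite /zeta aut_funM; set d := x^-1 * _.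
have -> : (x * y)^-1 * (x ^@ s * y ^@ s) = y^-1 * d * y * (y^-1 * y ^@ s).
  by rewrite /d invgM !mulgA mulgK.
rewrite [rho (_ * y * _)]gmulfM [rho (_ * y)]gmulfM [rho (_ * d)]gmulfM.
by rewrite -(magnus_kernel_central s x) homV mulgVK.
Qed.

Let zeta_derived s x : derived x -> zeta s x = 1.
Proof.
by apply: derived_commuting => [|y z]; [apply: zetaM|apply: magnus_kernel_central].
Qed.

(** With d = x^-1 x^s in F', one has x^(s t) = x^t d^t; as zeta t kills F', the
    factor d^t has the same image under rho as d. *)
Lemma magnus_kernel_defectM s t x :
  rho (x^-1 * x ^@ (s * t)) = rho (x^-1 * x ^@ s) * rho (x^-1 * x ^@ t).
Proof.
have dx : derived (x^-1 * x ^@ s) by apply/abP; rewrite IA_ab.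
have -> : x ^@ (s * t) = (x ^@ s) ^@ t by [].
have {1}-> : x ^@ s = x * (x^-1 * x ^@ s) by rewrite mulVKg.
rewrite aut_funM mulgA gmulfM magnus_kernel_central; congr (_ * _).
have := zeta_derived t dx; rewrite /zeta gmulfM homV => h.
by rewrite -[RHS]mulg1 -h mulVKg.
Qed.

Lemma magnus_kernel_defect_derived s x :
  derived s -> rho (x^-1 * x ^@ s) = 1.
Proof.
apply: (@derived_commuting _ _ (fun s => rho (x^-1 * x ^@ s))) => [t t'|t t'].
  exact: magnus_kernel_defectM.
exact: magnus_kernel_central.
Qed.

End Detection.

(** * A criterion for belonging to the Magnus kernel *)

Section MagnusKernelMembership.
Variable n : nat.
Local Notation F := (free_group n).
Local Notation fox_ab j w := (gr_map (@ab F) (fox j (gr w))).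

Lemma fox_abM j (u v : F) : derived u ->
  fox_ab j (u * v) = (fox_ab j u + fox_ab j v)%R.
Proof.
by move=> /ab_eq1 u1; rewrite foxM gr_mapD (gr_mapM (@abM _)) gr_mapU u1 mul1r.
Qed.

(** On F' the abelianized Fox derivatives are additive ([fox_abM]), hence they
    vanish on F''. *)
Lemma fox_ab_comm j (u v : F) : derived u -> derived v ->
  fox_ab j [~ u, v] = 0%R.
Proof.
have VE w : derived w -> fox_ab j w^-1 = (- fox_ab j w)%R.
  move=> dw; apply/eqP; rewrite -addr_eq0 -(fox_abM j w (DerivedV dw)).
  by rewrite mulVg fox1 raddf0.
move=> du dv; rewrite /commg /conjg !fox_abM ?VE //; try exact: DerivedV.
by rewrite [(fox_ab j u + _)%R]addrC addKr addNr.
Qed.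

Lemma in_magnus_kernel_fox (s : IA F) :
  (forall i j, fox_ab j ((fg_gen i)^-1 * val s (fg_gen i)) = 0%R) ->
  in_magnus_kernel s.
Proof.
move=> h; apply/eqP/matrixP => i j; rewrite !mxE.
rewrite -[val s _](mulVKg (fg_gen i)) foxM gr_mapD (gr_mapM (@abM _)) h mulr0.
by rewrite addr0 fox_gen; case: eqP => _; rewrite ?raddf0 // -gr1 gr_mapU.
Qed.

End MagnusKernelMembership.

(** * Restriction to W as an element of IA(W) *)

Section RestrictIA.
Variables n d : nat.
Local Notation F := (free_group n).

(** The subgroup [W, W], seen inside F so that conjugation by elements of F
    outside W makes sense. *)
Definition W_derived (u : F) : Prop := exists2 w : W n d, derived w & val w = u.

Lemma W_valV (w : W n d) : val w^-1 = (val w)^-1.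
Proof. exact: homV. Qed.

Lemma in_W_derived (u : F) : derived u -> in_W d u.
Proof. by move=> du; apply/eqP/(derived_comm (to_cyclic d))/du/Zp_mulgC. Qed.

Lemma in_W_gen (i : 'I_n) : val i != 0%N -> in_W d (fg_gen i).
Proof. by move=> /negbTE i0; rewrite /in_W /to_cyclic free_lift_gen i0. Qed.

Lemma W_derivedR (u v : F) : in_W d u -> in_W d v -> W_derived [~ u, v].
Proof.
move=> hu hv; exists [~ exist _ u hu : W n d, exist _ v hv : W n d] => //.
exact: DerivedR.
Qed.

Lemma W_derived1 : W_derived 1.
Proof. by exists 1 => //; apply: Derived1. Qed.

Lemma W_derivedM (u v : F) : W_derived u -> W_derived v -> W_derived (u * v).
Proof.
by case=> [x dx <-] [y dy <-]; exists (x * y); [apply: DerivedM | rewrite valM].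
Qed.

Lemma W_derivedV (u : F) : W_derived u -> W_derived u^-1.
Proof. by case=> [x dx <-]; exists x^-1; [apply: DerivedV | rewrite W_valV]. Qed.

Lemma W_derivedJ (u v : F) : W_derived u -> W_derived (u ^ v).
Proof.
have inJ (w : W n d) : in_W d (val w ^ v).
  rewrite /in_W /conjg to_cyclicM to_cyclicM (eqP (valP w)) mul1g.
  by rewrite -to_cyclicM mulVg to_cyclic1.
case=> x + <-; elim=> [|y z|y z _ dy _ dz|y _ dy].
- by rewrite conj1g; apply: W_derived1.
- by rewrite -[val _]/[~ val y, val z] conjRg; apply: W_derivedR.
- by rewrite valM conjMg; apply: W_derivedM.
- by rewrite W_valV conjVg; apply: W_derivedV.
Qed.

(** Modulo the normal subgroup [W, W] of F, the automorphism s agrees with the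
    identity on the generators of F, hence on F and a fortiori on W. *)
Lemma restrict_W_IA (s : IA F) :
  (forall i, W_derived ((fg_gen i)^-1 * val s (fg_gen i))) ->
  is_IA (restrict_W d s).
Proof.
move=> hs; have {}hs u : W_derived (u^-1 * val s u).
  elim/free_group_ind: u => [|//|u v hu hv|u hu].
  - by rewrite (hom1 (val s)) mulg1 invg1; apply: W_derived1.
  - rewrite aut_funM (_ : _ * _ = (u^-1 * val s u) ^ v * (v^-1 * val s v)).
      by apply: W_derivedM => //; apply: W_derivedJ.
    by rewrite /conjg invgM !mulgA mulgK.
  - rewrite (homV (val s)) (_ : _ * _ = ((u^-1 * val s u) ^ u^-1)^-1).
      exact/W_derivedV/W_derivedJ.
    by rewrite /conjg !invgM !invgK !mulgA mulgK.
apply/is_IAP => w; apply/esym/abP.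
have [w' dw' e] := hs (val w).
suff -> : w^-1 * restrict_W d s w = w' by [].
by apply: val_inj; rewrite e valM W_valV.
Qed.

End RestrictIA.

(** * Automorphisms moving one generator *)

Section Transvections.
Variables (n : nat) (k : 'I_n).
Local Notation F := (free_group n).
Implicit Types (a b u v w : F).

Definition transv a b : F -> F :=
  free_lift (fun i => if i == k then a * fg_gen k * b else fg_gen i).
HB.instance Definition _ a b := UMagmaMorphism.on (transv a b).

Lemma transv_gen a b i :
  transv a b (fg_gen i) = if i == k then a * fg_gen k * b else fg_gen i.
Proof. exact: free_lift_gen. Qed.

Lemma transvM a b : {morph transv a b : u v / u * v}.
Proof. exact: gmulfM. Qed.

Lemma transvV a b : {morph transv a b : u / u^-1}.
Proof. exact: homV. Qed.

(** Elements of the subgroup generated by the x_i with i != k, which these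
    endomorphisms fix; the form below is the property that computations use. *)
Definition avoids w : Prop := forall a b, transv a b w = w.

Lemma avoids_gen i : i != k -> avoids (fg_gen i).
Proof. by move=> /negbTE ik a b; rewrite transv_gen ik. Qed.

Lemma avoids1 : avoids 1.
Proof. by move=> a b; apply: hom1. Qed.

Lemma avoidsM u v : avoids u -> avoids v -> avoids (u * v).
Proof. by move=> hu hv a b; rewrite transvM hu hv. Qed.

Lemma avoidsV u : avoids u -> avoids u^-1.
Proof. by move=> hu a b; rewrite transvV hu. Qed.

Lemma avoidsR u v : avoids u -> avoids v -> avoids [~ u, v].
Proof.
move=> hu hv; rewrite /commg /conjg.
by do ![apply: avoidsM | apply: avoidsV | assumption].
Qed.

Lemma transv_comp a b a' b' w : avoids a -> avoids b ->
  transv a' b' (transv a b w) = transv (a * a') (b' * b) w.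
Proof.
move=> ha hb; elim/free_group_ind: w => [|i|u v hu hv|u hu].
- by rewrite !hom1.
- rewrite !transv_gen; case: eqP => [_|/eqP ik]; last exact: avoids_gen.
  by rewrite !transvM ha hb transv_gen eqxx !mulgA.
- by rewrite !transvM hu hv.
- by rewrite !transvV hu.
Qed.

Lemma transv1 w : transv 1 1 w = w.
Proof.
elim/free_group_ind: w => [|i|u v hu hv|u hu].
- exact: hom1.
- by rewrite transv_gen; case: eqP => // ->; rewrite mul1g mulg1.
- by rewrite transvM hu hv.
- by rewrite transvV hu.
Qed.

Lemma transv_bij a b : avoids a -> avoids b -> bijective (transv a b).
Proof.
move=> ha hb; exists (transv a^-1 b^-1) => w; rewrite transv_comp //.
- by rewrite mulgV mulVg transv1.
- by rewrite mulVg mulgV transv1.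
- exact: avoidsV.
- exact: avoidsV.
Qed.

Definition transv_aut a b (ha : avoids a) (hb : avoids b) : aut F :=
  Aut (@transvM a b) (transv_bij ha hb).

Lemma transv_IA a b : avoids a -> avoids b -> derived (a * b) ->
  exists s : IA F, val s =1 transv a b.
Proof.
move=> ha hb /ab_eq1; rewrite abM => dab.
suff h : is_IA (transv_aut ha hb) by exists (exist (@is_IA F) _ h).
apply/is_IAP => w; rewrite -[transv_aut _ _ w]/(transv a b w).
elim/free_group_ind: w => [|i|u v hu hv|u hu].
- by rewrite hom1.
- rewrite transv_gen; case: eqP => // ->.
  by rewrite !abM [_ * ab (fg_gen k)]abelianizationC -mulgA dab mulg1.
- by rewrite gmulfM !abM hu hv.
- by rewrite transvV !abV hu.
Qed.

(** Composing the four automorphisms multiplies the left factors of x_k to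
    c c^-1 and the right factors to c g c^-1 g^-1. *)
Lemma transv_comm (s t : IA F) g c : avoids g -> avoids c ->
  val s =1 transv 1 g -> val t =1 transv c^-1 c ->
  val [~ s, t] =1 transv 1 [~ c^-1, g^-1].
Proof.
move=> hg hc hs ht w.
have hcV := avoidsV hc; have hgV := avoidsV hg; have h1 := avoids1.
have inv (r : IA F) a b : avoids a -> avoids b -> val r =1 transv a b ->
    val r^-1 =1 transv a^-1 b^-1.
  move=> ha hb hr v; have {1}-> : v = transv a b (transv a^-1 b^-1 v).
    by rewrite transv_comp ?mulVg ?mulgV ?transv1 //; apply: avoidsV.
  by rewrite -hr -aut_mulE -valM mulgV.
have -> : val [~ s, t] w = val t (val s (val t^-1 (val s^-1 w))) by [].
rewrite (inv _ _ _ _ _ hs) // (inv _ _ _ _ _ ht) // hs ht.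
do ![rewrite transv_comp; do ?[apply: avoidsM | apply: avoidsV | assumption]].
congr (transv _ _ w); rewrite ?invg1 ?invgK ?mul1g ?mulg1 ?mulgV //.
by rewrite /commg /conjg !invgK !mulgA.
Qed.

End Transvections.

(** * The class *)

(** Counting from 0, the generators x_0 and x_2 go to the two standard generators
    of the Heisenberg group, and x_1 to the involution inverting both. *)
Definition heis_rep n : free_group n -> heis := free_lift (fun i : 'I_n =>
  match val i return heis with
  | 0 => (false, 1, 0, 0)
  | 1 => (true, 0, 0, 0)
  | 2 => (false, 0, 1, 0)
  | _ => heis_one
  end)%R.
HB.instance Definition _ n := UMagmaMorphism.on (@heis_rep n).

Theorem mainTheorem3 (n : nat) (hn : (4 <= n)%N) :
  exists a : abelianization (magnus_kernel n),
    a <> 1 /\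
    forall d : nat, (3 <= d)%N -> ab_map (@embed_IA_W n d) a = 1.
Proof.
pose o i (hi : (i < 4)%N) : 'I_n := Ordinal (leq_trans hi hn).
pose x0 : free_group n := fg_gen (@o 0%N isT).
pose x1 : free_group n := fg_gen (@o 1%N isT).
pose x2 : free_group n := fg_gen (@o 2%N isT).
pose k := @o 3%N isT; pose x3 : free_group n := fg_gen k.
pose c := [~ x0, x1]; pose g := [~ x1, x2].
have dc : derived c by apply: DerivedR.
have dg : derived g by apply: DerivedR.
have ac : avoids k c by apply: avoidsR; apply: avoids_gen.
have ag : avoids k g by apply: avoidsR; apply: avoids_gen.
have [s hs] : exists s : IA (free_group n), val s =1 transv k 1 g.
  by apply: transv_IA; [apply: avoids1 | | rewrite mul1g].
have [t ht] : exists t : IA (free_group n), val t =1 transv k c^-1 c.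
  apply: transv_IA; [exact: (avoidsV ac) | exact: ac |].
  by rewrite mulVg; apply: Derived1.
pose f := [~ c^-1, g^-1].
have rE : val [~ s, t] =1 transv k 1 f := transv_comm ag ac hs ht.
have r_kernel : in_magnus_kernel [~ s, t].
  apply: in_magnus_kernel_fox => i j; rewrite rE transv_gen.
  case: eqP => [->|_]; last by rewrite mulVg fox1 raddf0.
  by rewrite mul1g mulKg fox_ab_comm //; apply: DerivedV.
pose r : magnus_kernel n := exist (@in_magnus_kernel n) _ r_kernel.
(* If the class were trivial, heis_rep f would be 1; it has z-coordinate
   different from 0. *)
exists (ab r); split=> [/ab_eq1 dr|d _].
  have := magnus_kernel_defect_derived (@heis_rep n) x3 dr.
  rewrite rE transv_gen eqxx mul1g mulKg.
  rewrite /f /c /g /commg /conjg !(gmulfM, homV) /= /x0 /x1 /x2.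
  by rewrite /heis_rep !free_lift_gen.
have sW : is_IA (restrict_W d s).
  apply: restrict_W_IA => i; rewrite hs transv_gen.
  case: eqP => [->|_]; last by rewrite mulVg; apply: W_derived1.
  by rewrite mul1g mulKg; apply: W_derivedR; apply: in_W_gen.
have tW : is_IA (restrict_W d t).
  apply: restrict_W_IA => i; rewrite ht transv_gen.
  case: eqP => [->|_]; last by rewrite mulVg; apply: W_derived1.
  rewrite -[c^-1 * _ * _]mulgA -[_ * _]/[~ fg_gen k, c].
  by apply: W_derivedR; [apply: in_W_gen | apply: in_W_derived].
rewrite ab_mapE; apply/ab_eq1.
suff /= -> : embed_IA_W d r =
    [~ exist (@is_IA (W n d)) _ sW : IA (W n d),
       exist (@is_IA (W n d)) _ tW : IA (W n d)].
  exact: DerivedR.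
apply: val_inj; rewrite /= /commg /conjg.
by rewrite !restrict_WM !(homV (restrict_W d)).
Qed.
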